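(* Let a pHDAE in block form $$E\dot x=(J-R)Qx+Bu,\qquad y=B^TQx$$ be given, with state $x=[x_1^T\ x_2^T\ x_3^T]^T$, $x_i\in\mathbb R^{n_i}$, $n=n_1+n_2+n_3$, structured as described in the context. Let $r<n_1$ (in applications $r\ll n_1$), let $\hat V\in\mathbb R^{n_1\times n_1}$ be invertible with $\hat V^{-1}x_1=[x_{1,r}^T\ x_{1,s}^T]^T$, $x_{1,r}\in\mathbb R^r$, $x_{1,s}\in\mathbb R^{n_1-r}$, and use the notation for the blocks of the correspondingly transformed system given in the context. Suppose that $J_{11}^{ss}$ is invertible. Then the reduced order model obtained by the Flow Constraint Reduction Method (FCRM) is port-Hamiltonian (i.e. a pHDAE) and, for the state $x^{\mathrm{fc}}=[x_{1,r}^T\ x_2^T\ x_3^T]^T\in\mathbb R^{r+n_2+n_3}$, is given by $$E^{\mathrm{fc}}\dot x^{\mathrm{fc}}=(J^{\mathrm{fc}}-R^{\mathrm{fc}})Q^{\mathrm{fc}}x^{\mathrm{fc}}+(B^{\mathrm{fc}}-P^{\mathrm{fc}})u,\qquad y^{\mathrm{fc}}=(B^{\mathrm{fc}}+P^{\mathrm{fc}})^TQ^{\mathrm{fc}}x^{\mathrm{fc}}+(S^{\mathrm{fc}}+N^{\mathrm{fc}})u,$$ where $$E^{\mathrm{fc}}=\begin{bmatrix}I_r&0&0\\ 0&I_{n_2}&0\\ 0&0&0\end{bmatrix},\qquad Q^{\mathrm{fc}}=\begin{bmatrix}Q_{11}^{rr}&0&0\\ 0&0&0\\ Q_{31}^r&Q_{32}&Q_{33}\end{bmatrix},$$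 $$J^{\mathrm{fc}}=\mathcal J-\mathcal C^TZ_J\mathcal C,\quad R^{\mathrm{fc}}=\mathcal C^TZ_R\mathcal C,\quad B^{\mathrm{fc}}=-\mathcal B^T-\mathcal C^TZ_J\mathcal G,\quad P^{\mathrm{fc}}=\mathcal C^TZ_R\mathcal G,$$ $$S^{\mathrm{fc}}=\mathcal G^TZ_R\mathcal G,\quad N^{\mathrm{fc}}=\mathcal G^TZ_J\mathcal G-\mathcal N,$$ with $\mathcal J=[\mathcal J_{kl}]_{k,l=1,2,3}=-\mathcal J^T$ given by $$\mathcal J_{11}=J_{11}^{rr}-J_{11}^{rs}(J_{11}^{ss})^{-1}J_{11}^{sr},\quad \mathcal J_{1j}=J_{1j}^r-J_{11}^{rs}(J_{11}^{ss})^{-1}J_{1j}^s,\quad \mathcal J_{2j}=J_{2j}-J_{21}^s(J_{11}^{ss})^{-1}J_{1j}^s\quad(j=2,3),$$ $$\mathcal J_{33}=J_{33}-J_{31}^s(J_{11}^{ss})^{-1}J_{13}^s,$$ with the block rows $\mathcal B=[\mathcal B_1\ \mathcal B_2\ \mathcal B_3]$, $\mathcal C=[\mathcal C_1\ \mathcal C_2\ \mathcal C_3]$ given by $$\mathcal B_1=(B_1^s)^T(J_{11}^{ss})^{-1}J_{11}^{sr}-(B_1^r)^T,\qquad \mathcal B_j=(B_1^s)^T(J_{11}^{ss})^{-1}J_{1j}^s-B_j^T\quad(j=2,3),$$ $$\mathcal C_1=(C_1^s)^T(J_{11}^{ss})^{-1}J_{11}^{sr}-(C_1^r)^T,\qquad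 \mathcal C_j=(C_1^s)^T(J_{11}^{ss})^{-1}J_{1j}^s-C_j^T\quad(j=2,3),$$ with $$\mathcal G=(C_1^s)^T(J_{11}^{ss})^{-1}B_1^s,\qquad \mathcal D=(C_1^s)^T(J_{11}^{ss})^{-1}C_1^s,\qquad \mathcal N=(B_1^s)^T(J_{11}^{ss})^{-1}B_1^s,$$ and with $Z=\hat R(I-\mathcal D\hat R)^{-1}$, $Z_R=(Z+Z^T)/2$, $Z_J=(Z-Z^T)/2$.
   Context: **pHDAE.** A system $E\dot x=(J-R)Qx+(B-P)u$, $y=(B+P)^TQx+(S+N)u$ with real matrices $E,Q,J,R\in\mathbb R^{n\times n}$, $B,P\in\mathbb R^{n\times m}$, $S=S^T,N=-N^T\in\mathbb R^{m\times m}$ is called a port-Hamiltonian differential-algebraic system (pHDAE) if: (1) $Q^TJ^TQ=-Q^TJQ$ and $Q^TE=E^TQ$; (2) $Q^TE=E^TQ\ge0$ (positive semidefinite); (3) the passivity matrix $W=\begin{bmatrix}Q^TRQ&Q^TP\\ P^TQ&S\end{bmatrix}$ satisfies $W=W^T\ge0$. **Block form of the full system.** Here $P=S=N=0$, and with respect to $\mathbb R^n=\mathbb R^{n_1}\times\mathbb R^{n_2}\times\mathbb R^{n_3}$, $$E=\begin{bmatrix}I_{n_1}&0&0\\ 0&I_{n_2}&0\\ 0&0&0\end{bmatrix},\quad Q=\begin{bmatrix}Q_{11}&0&0\\ 0&0&0\\ Q_{31}&Q_{32}&Q_{33}\end{bmatrix},\quad J=[J_{ij}],\quad R=[R_{ij}],\quad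 B=\begin{bmatrix}B_1\\ B_2\\ B_3\end{bmatrix}\in\mathbb R^{n\times m},$$ with $J=-J^T$, $R=R^T\ge0$, $J_{j3}-R_{j3}=0$ for $j=1,2$, $Q_{11}=Q_{11}^T>0$ and $Q_{33}$ nonsingular. **Transformed system.** Put $V=\mathrm{diag}(\hat V,I_{n_2},I_{n_3})$. The transformed system has state $[x_{1,r}^T\ x_{1,s}^T\ x_2^T\ x_3^T]^T=V^{-1}x$ and matrices $V^{-1}EV=E$, $V^{-1}JV^{-T}$, $V^{-1}RV^{-T}$, $V^TQV$, $V^{-1}B$. Their blocks with respect to the partition $(x_{1,r},x_{1,s},x_2,x_3)$ are denoted $$V^{-1}JV^{-T}=\begin{bmatrix}J_{11}^{rr}&J_{11}^{rs}&J_{12}^r&J_{13}^r\\ J_{11}^{sr}&J_{11}^{ss}&J_{12}^s&J_{13}^s\\ J_{21}^r&J_{21}^s&J_{22}&J_{23}\\ J_{31}^r&J_{31}^s&J_{32}&J_{33}\end{bmatrix},\quad V^TQV=\begin{bmatrix}Q_{11}^{rr}&Q_{11}^{rs}&0&0\\ (Q_{11}^{rs})^T&Q_{11}^{ss}&0&0\\ 0&0&0&0\\ Q_{31}^r&Q_{31}^s&Q_{32}&Q_{33}\end{bmatrix},\quad V^{-1}B=\begin{bmatrix}B_1^r\\ B_1^s\\ B_2\\ B_3\end{bmatrix}.$$ **Port representation.** Write $V^{-1}RV^{-T}=C\hat RC^T$ with $0<\hat R=\hat R^T\in\mathbb R^{\ell\times\ell}$ and $C\in\mathbb R^{n\times\ell}$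 with orthonormal columns (from an ordered Schur decomposition), and partition $C=[(C_1^r)^T\ (C_1^s)^T\ C_2^T\ C_3^T]^T$. With flows $f_x=-(V^{-1}EV)V^{-1}x'$ (where $x'=\dot x$), efforts $e_x=(V^TQV)V^{-1}x$, $e_R=C^Te_x$, $f_R=-\hat Re_R$, the transformed system is equivalent to $$-f_x=(V^{-1}JV^{-T})e_x+Cf_R+V^{-1}Bu,\qquad 0=-(V^{-1}B)^Te_x+y,\qquad 0=-C^Te_x+e_R,$$ where $f_x$, $e_x$ are partitioned as $(x_{1,r},x_{1,s},x_2,x_3)$. **FCRM.** When $J_{11}^{ss}$ is invertible, the reduced model by FCRM is obtained by: imposing $f_{x_{1,s}}=0$ and $\dot x_{1,s}=0$ in these equations, with the choice $x_{1,s}=0$ in the constitutive relations of the remaining efforts (so $e_{x_{1,r}}=Q_{11}^{rr}x_{1,r}$, $e_{x_2}=0$, $e_{x_3}=Q_{31}^rx_{1,r}+Q_{32}x_2+Q_{33}x_3$); eliminating $e_{x_{1,s}}$ from the whole system (i.e. multiplying from the left by a matrix of maximal rank annihilating the coefficient block column of $e_{x_{1,s}}$, namely $$\begin{bmatrix}I_r&-J_{11}^{rs}(J_{11}^{ss})^{-1}&0&0&0&0\\ 0&-J_{21}^s(J_{11}^{ss})^{-1}&I_{n_2}&0&0&0\\ 0&-J_{31}^s(J_{11}^{ss})^{-1}&0&I_{n_3}&0&0\\ 0&(B_1^s)^T(J_{11}^{ss})^{-1}&0&0&I_m&0\\ 0&(C_1^s)^T(J_{11}^{ss})^{-1}&0&0&0&I_\ell\end{bmatrix},$$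 where the block rows of the representation are ordered as the four rows for $f_{x_{1,r}},f_{x_{1,s}},f_{x_2},f_{x_3}$, then the row for $y$, then the row for $e_R$); inserting $f_{x_{1,r}}=-\dot x_{1,r}$, $f_{x_2}=-\dot x_2$, $f_{x_3}=0$; and eliminating $f_R,e_R$ through $f_R=-\hat Re_R$ (closing the resistive port). The resulting output is denoted $y^{\mathrm{fc}}$. *)

(* Defs.v *)
From mathcomp Require Export all_boot all_order all_algebra.
From mathcomp Require Export all_classical all_reals all_analysis.
Export Order.TTheory GRing.Theory Num.Theory.
Export numFieldNormedType.Exports.

Set Implicit Arguments.
Unset Strict Implicit.
Unset Printing Implicit Defensive.

Local Open Scope ring_scope.

Definition psdmx (K : realType) (n : nat) (A : 'M[K]_n) : Prop :=
  A^T = A /\ forall x : 'cV[K]_n, 0 <= (x^T *m A *m x) 0 0.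

Definition pdmx (K : realType) (n : nat) (A : 'M[K]_n) : Prop :=
  A^T = A /\ forall x : 'cV[K]_n, x != 0 -> 0 < (x^T *m A *m x) 0 0.

Definition block3 (T : Type) (p1 p2 p3 q1 q2 q3 : nat)
  (A11 : 'M[T]_(p1, q1)) (A12 : 'M[T]_(p1, q2)) (A13 : 'M[T]_(p1, q3))
  (A21 : 'M[T]_(p2, q1)) (A22 : 'M[T]_(p2, q2)) (A23 : 'M[T]_(p2, q3))
  (A31 : 'M[T]_(p3, q1)) (A32 : 'M[T]_(p3, q2)) (A33 : 'M[T]_(p3, q3)) :
  'M[T]_(p1 + (p2 + p3), q1 + (q2 + q3)) :=
  block_mx A11 (row_mx A12 A13)
           (col_mx A21 A31) (block_mx A22 A23 A32 A33).

(* The system  E x' = (J - R) Q x + (B - P) u,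
               y    = (B + P)^T Q x + (S + N) u. *)
Record dae (K : realType) (n m : nat) := Dae {
  sysE : 'M[K]_n;
  sysJ : 'M[K]_n;
  sysR : 'M[K]_n;
  sysQ : 'M[K]_n;
  sysB : 'M[K]_(n, m);
  sysP : 'M[K]_(n, m);
  sysS : 'M[K]_m;
  sysN : 'M[K]_m }.

Definition passivity_mx (K : realType) (n m : nat) (H : dae K n m) :
    'M[K]_(n + m) :=
  block_mx ((sysQ H)^T *m sysR H *m sysQ H) ((sysQ H)^T *m sysP H)
           ((sysP H)^T *m sysQ H)           (sysS H).

Record is_pHDAE (K : realType) (n m : nat) (H : dae K n m) : Prop := IsPHDAE {
  pHDAE_S : sysS H = (sysS H)^T;
  pHDAE_N : sysN H = - (sysN H)^T;
  pHDAE_J : (sysQ H)^T *m (sysJ H)^T *m sysQ H =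
            - ((sysQ H)^T *m sysJ H *m sysQ H);
  pHDAE_QE : (sysQ H)^T *m sysE H = (sysE H)^T *m sysQ H;
  pHDAE_QE_ge0 : psdmx ((sysQ H)^T *m sysE H);
  pHDAE_W : psdmx (passivity_mx H) }.

Definition dae_solution (K : realType) (n m : nat) (H : dae K n m) (I : set K)
    (x : K -> 'cV[K]_n) (u y : K -> 'cV[K]_m) : Prop :=
  forall t : K, I t ->
    [/\ derivable x t 1,
        sysE H *m derive1 x t =
          (sysJ H - sysR H) *m sysQ H *m x t + (sysB H - sysP H) *m u t
      & y t = (sysB H + sysP H)^T *m sysQ H *m x t + (sysS H + sysN H) *m u t].

Definition block_pHDAE (K : realType) (n1 n2 n3 m : nat)
    (Q11 : 'M[K]_n1) (Q31 : 'M[K]_(n3, n1)) (Q32 : 'M[K]_(n3, n2))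
    (Q33 : 'M[K]_n3) (J R : 'M[K]_(n1 + (n2 + n3)))
    (B : 'M[K]_(n1 + (n2 + n3), m)) : dae K (n1 + (n2 + n3)) m :=
  {| sysE := block3 1%:M 0 0 0 1%:M 0 0 0 0;
     sysJ := J;
     sysR := R;
     sysQ := block3 Q11 0 0 0 0 0 Q31 Q32 Q33;
     sysB := B;
     sysP := 0;
     sysS := 0;
     sysN := 0 |}.

Definition state_transf (K : realType) (n1 n2 n3 : nat) (Vhat : 'M[K]_n1) :
    'M[K]_(n1 + (n2 + n3)) :=
  block3 Vhat 0 0 0 1%:M 0 0 0 1%:M.

(* Coefficients of a port representation whose state is partitioned as
   (x_{1,r}, x_{1,s}, x_2, x_3), so that n_1 = r + s, with
   E = diag(I, I, I, 0). *)
Record port_rep (K : realType) (r s n2 n3 m l : nat) := PortRep {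
  portJ : 'M[K]_(r + s + (n2 + n3));
  portQ : 'M[K]_(r + s + (n2 + n3));
  portB : 'M[K]_(r + s + (n2 + n3), m);
  portC : 'M[K]_(r + s + (n2 + n3), l);
  portRhat : 'M[K]_l }.

Definition transformed_port_rep (K : realType) (r s n2 n3 m l : nat)
    (H : dae K (r + s + (n2 + n3)) m) (Vhat : 'M[K]_(r + s))
    (C : 'M[K]_(r + s + (n2 + n3), l)) (Rhat : 'M[K]_l) :
    port_rep K r s n2 n3 m l :=
  let V := state_transf n2 n3 Vhat in
  {| portJ := invmx V *m sysJ H *m (invmx V)^T;
     portQ := V^T *m sysQ H *m V;
     portB := invmx V *m sysB H;
     portC := C;
     portRhat := Rhat |}.

Section Blocks.
Context (K : realType) (r s n2 n3 m l : nat) (D : port_rep K r s n2 n3 m l).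

Definition J11rr : 'M[K]_r := ulsubmx (ulsubmx (portJ D)).
Definition J11rs : 'M[K]_(r, s) := ursubmx (ulsubmx (portJ D)).
Definition J11sr : 'M[K]_(s, r) := dlsubmx (ulsubmx (portJ D)).
Definition J11ss : 'M[K]_s := drsubmx (ulsubmx (portJ D)).
Definition J12r : 'M[K]_(r, n2) := ulsubmx (ursubmx (portJ D)).
Definition J13r : 'M[K]_(r, n3) := ursubmx (ursubmx (portJ D)).
Definition J12s : 'M[K]_(s, n2) := dlsubmx (ursubmx (portJ D)).
Definition J13s : 'M[K]_(s, n3) := drsubmx (ursubmx (portJ D)).
Definition J21s : 'M[K]_(n2, s) := ursubmx (dlsubmx (portJ D)).
Definition J31s : 'M[K]_(n3, s) := drsubmx (dlsubmx (portJ D)).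
Definition J22 : 'M[K]_n2 := ulsubmx (drsubmx (portJ D)).
Definition J23 : 'M[K]_(n2, n3) := ursubmx (drsubmx (portJ D)).
Definition J33 : 'M[K]_n3 := drsubmx (drsubmx (portJ D)).

Definition Q11rr : 'M[K]_r := ulsubmx (ulsubmx (portQ D)).
Definition Q31r : 'M[K]_(n3, r) := dlsubmx (dlsubmx (portQ D)).
Definition Q32 : 'M[K]_(n3, n2) := dlsubmx (drsubmx (portQ D)).
Definition Q33 : 'M[K]_n3 := drsubmx (drsubmx (portQ D)).

Definition B1r : 'M[K]_(r, m) := usubmx (usubmx (portB D)).
Definition B1s : 'M[K]_(s, m) := dsubmx (usubmx (portB D)).
Definition B2 : 'M[K]_(n2, m) := usubmx (dsubmx (portB D)).
Definition B3 : 'M[K]_(n3, m) := dsubmx (dsubmx (portB D)).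

Definition C1r : 'M[K]_(r, l) := usubmx (usubmx (portC D)).
Definition C1s : 'M[K]_(s, l) := dsubmx (usubmx (portC D)).
Definition C2 : 'M[K]_(n2, l) := usubmx (dsubmx (portC D)).
Definition C3 : 'M[K]_(n3, l) := dsubmx (dsubmx (portC D)).

(* The port representation is [port_residual fx ex fR eR u y = 0], i.e.
     -fx = J ex + C fR + B u,   0 = - B^T ex + y,   0 = - C^T ex + eR. *)
Definition port_residual (fx ex : 'cV[K]_(r + s + (n2 + n3)))
    (fR eR : 'cV[K]_l) (u y : 'cV[K]_m) :
    'cV[K]_(r + s + (n2 + n3) + (m + l)) :=
  col_mx (fx + portJ D *m ex + portC D *m fR + portB D *m u)
         (col_mx (- (portB D)^T *m ex + y) (- (portC D)^T *m ex + eR)).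

Definition row6 (p : nat) (A1 : 'M[K]_(p, r)) (A2 : 'M[K]_(p, s))
    (A3 : 'M[K]_(p, n2)) (A4 : 'M[K]_(p, n3)) (A5 : 'M[K]_(p, m))
    (A6 : 'M[K]_(p, l)) : 'M[K]_(p, r + s + (n2 + n3) + (m + l)) :=
  row_mx (row_mx (row_mx A1 A2) (row_mx A3 A4)) (row_mx A5 A6).

(* Maximal-rank left annihilator of the coefficient of e_{x_{1,s}} in
   [port_residual]; see [fcrm_elim_mxK] and [fcrm_elim_mx_row_free]. *)
Definition fcrm_elim_mx :
    'M[K]_(r + (n2 + n3) + (m + l), r + s + (n2 + n3) + (m + l)) :=
  let Jinv := invmx J11ss in
  col_mx
    (col_mx         (row6 1%:M (- (J11rs *m Jinv)) 0    0    0    0)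
            (col_mx (row6 0    (- (J21s *m Jinv))  1%:M 0    0    0)
                    (row6 0    (- (J31s *m Jinv))  0    1%:M 0    0)))
            (col_mx (row6 0    (B1s^T *m Jinv)     0    0    1%:M 0)
                    (row6 0    (C1s^T *m Jinv)     0    0    0    1%:M)).

Definition fcrm_flow (dx : 'cV[K]_(r + (n2 + n3))) :
    'cV[K]_(r + s + (n2 + n3)) :=
  let dx1r := usubmx dx in
  let dx2 := usubmx (dsubmx dx) in
  col_mx (col_mx (- dx1r) 0) (col_mx (- dx2) 0).

(* The effort e_{x_{1,s}} stays free; the other ones follow from the
   constitutive relations with x_{1,s} = 0. *)
Definition fcrm_effort (x : 'cV[K]_(r + (n2 + n3))) (e1s : 'cV[K]_s) :
    'cV[K]_(r + s + (n2 + n3)) :=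
  let x1r := usubmx x in
  let x2 := usubmx (dsubmx x) in
  let x3 := dsubmx (dsubmx x) in
  col_mx (col_mx (Q11rr *m x1r) e1s)
         (col_mx 0 (Q31r *m x1r + Q32 *m x2 + Q33 *m x3)).

(* Reduced model: [e1s] drops out after the multiplication by the annihilator,
   and the resistive port is closed by fR = - Rhat eR. *)
Definition fcrm_solution (I : set K) (x : K -> 'cV[K]_(r + (n2 + n3)))
    (u y : K -> 'cV[K]_m) : Prop :=
  (forall t, I t -> derivable x t 1) /\
  exists (e1s : K -> 'cV[K]_s) (fR eR : K -> 'cV[K]_l), forall t, I t ->
    fcrm_elim_mx *m port_residual (fcrm_flow (derive1 x t))
      (fcrm_effort (x t) (e1s t)) (fR t) (eR t) (u t) (y t) = 0
    /\ fR t = - portRhat D *m eR t.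

Lemma fcrm_elim_mxK : J11ss \in unitmx ->
  fcrm_elim_mx *m col_mx (col_mx (col_mx J11rs J11ss) (col_mx J21s J31s))
                         (col_mx (- B1s^T) (- C1s^T)) = 0.
Proof.
move=> uJ; rewrite /fcrm_elim_mx /row6 !mul_col_mx !mul_row_col.
rewrite !mul1mx !mul0mx ?add0r ?addr0 !mulNmx !mulmxKV // !subrr.
by rewrite !addNr !col_mx0.
Qed.

Lemma fcrm_elim_mx_row_free : row_free fcrm_elim_mx.
Proof.
apply: inj_row_free => v.
rewrite -(hsubmxK v) -(hsubmxK (lsubmx v)) -(hsubmxK (rsubmx (lsubmx v))).
rewrite -(hsubmxK (rsubmx v)) /fcrm_elim_mx /row6 !mul_row_col.
rewrite !mul_mx_row !mulmx1 !mulmx0 !add_row_mx !addr0 !add0r -!row_mx0.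
move=> /eq_row_mx[/eq_row_mx[/eq_row_mx[-> _] /eq_row_mx[-> ->]]].
by move=> /eq_row_mx[-> ->].
Qed.

Definition calJ11 : 'M[K]_r := J11rr - J11rs *m invmx J11ss *m J11sr.
Definition calJ12 : 'M[K]_(r, n2) := J12r - J11rs *m invmx J11ss *m J12s.
Definition calJ13 : 'M[K]_(r, n3) := J13r - J11rs *m invmx J11ss *m J13s.
Definition calJ22 : 'M[K]_n2 := J22 - J21s *m invmx J11ss *m J12s.
Definition calJ23 : 'M[K]_(n2, n3) := J23 - J21s *m invmx J11ss *m J13s.
Definition calJ33 : 'M[K]_n3 := J33 - J31s *m invmx J11ss *m J13s.

(* The blocks below the diagonal are prescribed by skew-symmetry. *)
Definition calJ : 'M[K]_(r + (n2 + n3)) :=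
  block3   calJ11       calJ12    calJ13
        (- calJ12^T)    calJ22    calJ23
        (- calJ13^T) (- calJ23^T) calJ33.

Definition calB : 'M[K]_(m, r + (n2 + n3)) :=
  row_mx (B1s^T *m invmx J11ss *m J11sr - B1r^T)
         (row_mx (B1s^T *m invmx J11ss *m J12s - B2^T)
                 (B1s^T *m invmx J11ss *m J13s - B3^T)).

Definition calC : 'M[K]_(l, r + (n2 + n3)) :=
  row_mx (C1s^T *m invmx J11ss *m J11sr - C1r^T)
         (row_mx (C1s^T *m invmx J11ss *m J12s - C2^T)
                 (C1s^T *m invmx J11ss *m J13s - C3^T)).

Definition calG : 'M[K]_(l, m) := C1s^T *m invmx J11ss *m B1s.
Definition calD : 'M[K]_l := C1s^T *m invmx J11ss *m C1s.
Definition calN : 'M[K]_m := B1s^T *m invmx J11ss *m B1s.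

Definition fcZ : 'M[K]_l :=
  portRhat D *m invmx (1%:M - calD *m portRhat D).
Definition fcZR : 'M[K]_l := 2^-1 *: (fcZ + fcZ^T).
Definition fcZJ : 'M[K]_l := 2^-1 *: (fcZ - fcZ^T).

Definition fc_model : dae K (r + (n2 + n3)) m :=
  {| sysE := block3 1%:M 0 0 0 1%:M 0 0 0 0;
     sysJ := calJ - calC^T *m fcZJ *m calC;
     sysR := calC^T *m fcZR *m calC;
     sysQ := block3 Q11rr 0 0 0 0 0 Q31r Q32 Q33;
     sysB := - calB^T - calC^T *m fcZJ *m calG;
     sysP := calC^T *m fcZR *m calG;
     sysS := calG^T *m fcZR *m calG;
     sysN := calG^T *m fcZJ *m calG - calN |}.

End Blocks.

(* Main.v *)
From mathcomp Require Import lra.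
Require Import Defs.

(** The effort [e1s] of the truncated states enters every row of the port
    representation linearly, and its own flow row reads
    [0 = J11ss e1s + (terms in the other variables)].  As [J11ss] is
    invertible, that row can be solved for [e1s] and substituted elsewhere:
    this is Gaussian block elimination, that is, a Schur complement.  Let [P]
    embed the retained coordinates, [U] the truncated ones, and put
    [K0 = U J11ss^-1 U^T] and [T = P^T (1 - J K0)].  Then [T P = 1] and
    [T J U = 0], and all the coefficients of the reduced model without
    resistive closure become one-line expressions:
      [calJ = T J P = T J T^T], [calB = - (T B)^T], [calC = - (T C)^T],
      [calG = C^T K0 B], [calD = C^T K0 C], [calN = B^T K0 B].
    The skew-symmetry of [J] passes to [K0], and these expressions make it
    evident for [calJ], [calD] and [calN].

    After the elimination ([fcrm_residualE]), closing the resistive port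
    amounts to solving [(1 - calD Rhat) eR = - (calC e + calG u)].  Because
    [calD] is skew, [<(1 - calD Rhat) v, Rhat v> = <v, Rhat v>]
    ([quad_feedback]).  This single identity gives both the invertibility of
    [1 - calD Rhat] and, with [x = (1 - calD Rhat) v], the positivity
    [<x, Z x> = <v, Rhat v> >= 0] of [Z = Rhat (1 - calD Rhat)^-1].  The
    resistive flow is then [fR = Z (calC e + calG u)].  The splitting of [Z]
    into [ZR + ZJ] distributes the closed equations over the coefficients of
    the reduced model ([fc_modelE]), and its passivity matrix is the
    congruence of [ZR] by the block row [(calC Q, calG)], hence positive
    semidefinite ([fc_model_pHDAE]). *)

Set Implicit Arguments.
Unset Strict Implicit.
Unset Printing Implicit Defensive.

Local Open Scope classical_set_scope.
Local Open Scope ring_scope.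

(** * Quadratic forms and skew-symmetric matrices *)

Lemma trmx_form (K : realType) (n p q : nat) (A : 'M[K]_n)
    (M : 'M[K]_(n, p)) (N : 'M[K]_(n, q)) :
  (M^T *m A *m N)^T = N^T *m A^T *m M.
Proof. by rewrite !trmx_mul trmxK mulmxA. Qed.

Lemma trmx_skew_form (K : realType) (n p q : nat) (A : 'M[K]_n)
    (M : 'M[K]_(n, p)) (N : 'M[K]_(n, q)) :
  A^T = - A -> (M^T *m A *m N)^T = - (N^T *m A *m M).
Proof. by move=> skA; rewrite trmx_form skA mulmxN mulNmx. Qed.

Lemma quad_skew (K : realType) (n : nat) (A : 'M[K]_n) (x : 'cV[K]_n) :
  A^T = - A -> (x^T *m A *m x) 0 0 = 0.
Proof.
move=> skA; have := congr1 (fun M : 'M[K]_1 => M 0 0) (trmx_skew_form x x skA).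
by rewrite !mxE; lra.
Qed.

Lemma psdmx_congr (K : realType) (n p : nat) (A : 'M[K]_n) (X : 'M[K]_(n, p)) :
  psdmx A -> psdmx (X^T *m A *m X).
Proof.
move=> [symA A_ge0]; split=> [|x]; first by rewrite !trmx_mul trmxK symA mulmxA.
by have := A_ge0 (X *m x); rewrite trmx_mul !mulmxA.
Qed.

Lemma psd_ulsubmx (K : realType) (p q : nat) (A : 'M[K]_(p + q)) :
  psdmx A -> psdmx (ulsubmx A).
Proof.
move=> psdA; rewrite -[A]submxK in psdA.
have := psdmx_congr (col_mx 1%:M 0) psdA.
rewrite tr_col_mx trmx1 trmx0 mul_row_block mul_row_col.
by rewrite !mul1mx !mul0mx !addr0 mulmx1 mulmx0 addr0.
Qed.

Lemma pdmx_psdmx (K : realType) (n : nat) (A : 'M[K]_n) : pdmx A -> psdmx A.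
Proof.
move=> [symA A_gt0]; split=> // x.
have [->|/A_gt0/ltW//] := eqVneq x 0.
by rewrite mulmx0 mxE.
Qed.

(** * Feedback of a positive definite matrix through a skew-symmetric one *)

Section FeedbackLoop.
Context (K : realType) (l : nat) (S Rh : 'M[K]_l).
Hypotheses (skS : S^T = - S) (pdRh : pdmx Rh).

(** The skew part [S] does no work on [Rh v], so only the identity part of
    [1 - S Rh] contributes to the power. *)
Lemma quad_feedback (v : 'cV[K]_l) :
  (((1%:M - S *m Rh) *m v)^T *m (Rh *m v)) 0 0 = (v^T *m Rh *m v) 0 0.
Proof.
rewrite mulmxBl mul1mx linearB /= mulmxBl mulmxA.
have -> : (S *m Rh *m v)^T *m (Rh *m v) = - ((Rh *m v)^T *m S *m (Rh *m v)).
  by rewrite -[S *m Rh *m v]mulmxA (trmx_mul S) skS mulmxN mulNmx.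
by rewrite opprK [LHS]mxE (quad_skew _ skS) addr0.
Qed.

(** A vector killed by [1 - S Rh] has zero [Rh]-energy by [quad_feedback]. *)
Lemma feedback_unitmx : 1%:M - S *m Rh \in unitmx.
Proof.
rewrite -unitmx_tr -row_free_unit; apply: inj_row_free => w w0.
pose v := w^T.
have v0 : (1%:M - S *m Rh) *m v = 0.
  by rewrite -[LHS]trmxK trmx_mul trmxK w0 trmx0.
have := quad_feedback v; rewrite v0 trmx0 mul0mx mxE => q0.
apply/trmx_inj; rewrite trmx0; apply/eqP/negP => /negP /(pdRh.2).
by rewrite -/v -q0 ltxx.
Qed.

(** The substitution [x = (1 - S Rh) v] turns the quadratic form of [Z] into
    that of [Rh]; the symmetric part of [Z] has the same quadratic form. *)
Lemma feedback_sympart_psd :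
  let Z := Rh *m invmx (1%:M - S *m Rh) in psdmx (2^-1 *: (Z + Z^T)).
Proof.
move=> Z; split=> [|x].
  by rewrite linearZ /= linearD /= trmxK addrC.
pose v := invmx (1%:M - S *m Rh) *m x.
have xE : x = (1%:M - S *m Rh) *m v by rewrite /v mulKVmx // feedback_unitmx.
have ZE : (x^T *m Z *m x) 0 0 = (v^T *m Rh *m v) 0 0.
  by rewrite -quad_feedback -xE -!mulmxA.
have ZTE : (x^T *m Z^T *m x) 0 0 = (v^T *m Rh *m v) 0 0.
  rewrite -ZE; have -> : x^T *m Z^T *m x = (x^T *m Z *m x)^T.
    by rewrite !trmx_mul trmxK mulmxA.
  by rewrite mxE.
rewrite -scalemxAr -scalemxAl mulmxDr mulmxDl mxE mxE ZE ZTE.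
have := (pdmx_psdmx pdRh).2 v; lra.
Qed.

End FeedbackLoop.

(** * Block elimination of the truncated effort *)

Lemma row_mx_col (K : realType) (p1 p2 q1 q2 : nat) (A : 'M[K]_(p1, q1))
    (B : 'M[K]_(p2, q1)) (A' : 'M[K]_(p1, q2)) (B' : 'M[K]_(p2, q2)) :
  row_mx (col_mx A B) (col_mx A' B') = col_mx (row_mx A A') (row_mx B B').
Proof. by rewrite -block_mxEh block_mxEv. Qed.

(** This lets the blocks below the diagonal be ignored when two
    skew-symmetric matrices are compared. *)
Lemma skew_block3 (K : realType) (p1 p2 p3 : nat) (A11 : 'M[K]_p1)
    (A12 : 'M[K]_(p1, p2)) (A13 : 'M[K]_(p1, p3)) (L : 'M[K]_(p2 + p3, p1))
    (A22 : 'M[K]_p2) (A23 : 'M[K]_(p2, p3)) (L' : 'M[K]_(p3, p2))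
    (A33 : 'M[K]_p3)
    (A := block_mx A11 (row_mx A12 A13) L (block_mx A22 A23 L' A33)) :
  A^T = - A ->
  A = block3 A11 A12 A13 (- A12^T) A22 A23 (- A13^T) (- A23^T) A33.
Proof.
rewrite /A /block3 !tr_block_mx !opp_block_mx tr_row_mx => skA.
have [_ _ /(congr1 -%R)] := eq_block_mx skA.
rewrite opprK => <- /eq_block_mx[_ _ /(congr1 -%R)].
by rewrite opprK => <- _; rewrite opp_col_mx.
Qed.

Section Elimination.
Context (K : realType) (r s n2 n3 m l : nat) (D : port_rep K r s n2 n3 m l).

Local Notation J := (portJ D).
Local Notation B := (portB D).
Local Notation C := (portC D).

Definition keep_mx : 'M[K]_(r + s + (n2 + n3), r + (n2 + n3)) :=
  block_mx (col_mx 1%:M 0) 0 0 1%:M.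

Definition cut_mx : 'M[K]_(r + s + (n2 + n3), s) :=
  col_mx (col_mx 0 1%:M) 0.

Local Notation P := keep_mx.
Local Notation U := cut_mx.

(** The inverse of the restriction of [J] to the truncated coordinates,
    extended by zero, so that the elimination can be written without blocks. *)
Definition cut_inv : 'M[K]_(r + s + (n2 + n3)) :=
  U *m invmx (J11ss D) *m U^T.

(** Subtracts from the retained flow rows the multiple of the truncated one
    that clears their coefficient of the truncated effort. *)
Definition elim_mx : 'M[K]_(r + (n2 + n3), r + s + (n2 + n3)) :=
  P^T *m (1%:M - J *m cut_inv).

Lemma tr_keepE : P^T = block_mx (row_mx 1%:M 0) 0 0 1%:M.
Proof. by rewrite /P tr_block_mx tr_col_mx !trmx0 !trmx1. Qed.

Lemma tr_cutE : U^T = row_mx (row_mx 0 1%:M) 0.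
Proof. by rewrite /U !tr_col_mx !trmx0 !trmx1. Qed.

Lemma tr_keep_mul p (A1 : 'M[K]_(r, p)) (A2 : 'M[K]_(s, p))
    (A3 : 'M[K]_(n2 + n3, p)) :
  P^T *m col_mx (col_mx A1 A2) A3 = col_mx A1 A3.
Proof.
by rewrite tr_keepE mul_block_col mul_row_col !mul1mx !mul0mx !addr0 add0r.
Qed.

Lemma tr_cut_mul p (A1 : 'M[K]_(r, p)) (A2 : 'M[K]_(s, p))
    (A3 : 'M[K]_(n2 + n3, p)) :
  U^T *m col_mx (col_mx A1 A2) A3 = A2.
Proof. by rewrite tr_cutE !mul_row_col mul1mx !mul0mx addr0 add0r. Qed.

Lemma mul_keep p (A1 : 'M[K]_(p, r)) (A2 : 'M[K]_(p, s))
    (A3 : 'M[K]_(p, n2 + n3)) :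
  row_mx (row_mx A1 A2) A3 *m P = row_mx A1 A3.
Proof. by apply: trmx_inj; rewrite trmx_mul !tr_row_mx tr_keep_mul. Qed.

Lemma mul_cut p (A1 : 'M[K]_(p, r)) (A2 : 'M[K]_(p, s))
    (A3 : 'M[K]_(p, n2 + n3)) :
  row_mx (row_mx A1 A2) A3 *m U = A2.
Proof. by apply: trmx_inj; rewrite trmx_mul !tr_row_mx tr_cut_mul. Qed.

Lemma tr_keepK : P^T *m P = 1%:M.
Proof.
rewrite [in X in _ *m X]/P block_mxEv.
have -> : row_mx (col_mx 1%:M 0) (0 : 'M[K]_(r + s, n2 + n3)) =
   col_mx (row_mx 1%:M 0) (row_mx 0 0).
  by rewrite -block_mxEv block_mxEh col_mx0.
by rewrite tr_keep_mul -block_mxEv -scalar_mx_block.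
Qed.

Lemma tr_cut_keep : U^T *m P = 0.
Proof. by rewrite tr_cutE mul_keep row_mx0. Qed.

Lemma keep_cut_colE p (x : 'M[K]_(r + (n2 + n3), p)) (e : 'M[K]_(s, p)) :
  P *m x + U *m e = col_mx (col_mx (usubmx x) e) (dsubmx x).
Proof.
rewrite -{1}[x]vsubmxK /P mul_block_col /U !mul_col_mx !mul1mx !mul0mx.
by rewrite addr0 add0r add_col_mx add_col_mx !addr0 add0r.
Qed.

Lemma portC_blocks : C = col_mx (col_mx (C1r D) (C1s D)) (col_mx (C2 D) (C3 D)).
Proof. by rewrite !vsubmxK. Qed.

Lemma portB_blocks : B = col_mx (col_mx (B1r D) (B1s D)) (col_mx (B2 D) (B3 D)).
Proof. by rewrite !vsubmxK. Qed.

Lemma tr_cutJ : U^T *m J =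
  row_mx (row_mx (J11sr D) (J11ss D)) (row_mx (J12s D) (J13s D)).
Proof.
rewrite -{1}[J]submxK block_mxEv -{1}[ulsubmx J]submxK -{1}[ursubmx J]submxK.
by rewrite !block_mxEv -[X in col_mx X _]block_mxEh block_mxEv tr_cut_mul.
Qed.

Lemma Jcut : J *m U =
  col_mx (col_mx (J11rs D) (J11ss D)) (col_mx (J21s D) (J31s D)).
Proof.
rewrite -{1}[J]submxK block_mxEh -{1}[ulsubmx J]submxK -{1}[dlsubmx J]submxK.
by rewrite !block_mxEh -[X in row_mx X _]block_mxEv block_mxEh mul_cut.
Qed.

Lemma cutJcut : U^T *m J *m U = J11ss D.
Proof. by rewrite tr_cutJ mul_cut. Qed.

Lemma tr_cutJkeep : U^T *m J *m P = row_mx (J11sr D) (row_mx (J12s D) (J13s D)).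
Proof. by rewrite tr_cutJ mul_keep. Qed.

Lemma keepJcut : P^T *m J *m U = col_mx (J11rs D) (col_mx (J21s D) (J31s D)).
Proof. by rewrite -mulmxA Jcut tr_keep_mul. Qed.

Lemma tr_cut_portC : U^T *m C = C1s D.
Proof. by rewrite portC_blocks tr_cut_mul. Qed.

Lemma tr_cut_portB : U^T *m B = B1s D.
Proof. by rewrite portB_blocks tr_cut_mul. Qed.

Lemma elim_mxE : elim_mx =
  col_mx (row_mx (row_mx 1%:M (- (J11rs D *m invmx (J11ss D)))) 0)
 (col_mx (row_mx (row_mx 0 (- (J21s D *m invmx (J11ss D)))) (row_mx 1%:M 0))
         (row_mx (row_mx 0 (- (J31s D *m invmx (J11ss D)))) (row_mx 0 1%:M))).
Proof.
rewrite /elim_mx mulmxBr mulmx1 /cut_inv !mulmxA keepJcut tr_keepE tr_cutE.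
have -> : block_mx (row_mx 1%:M 0) 0 0 1%:M = col_mx (row_mx (row_mx 1%:M 0) 0)
    (col_mx (row_mx (row_mx 0 0) (row_mx 1%:M 0))
            (row_mx (row_mx 0 0) (row_mx 0 1%:M)))
    :> 'M[K]_(r + (n2 + n3), r + s + (n2 + n3)).
  rewrite !row_mx0 -[col_mx (row_mx 0 (row_mx 1%:M 0)) _]block_mxEv.
  rewrite [X in col_mx _ X]block_mxEh -[col_mx (row_mx 1%:M 0) _]block_mxEv.
  by rewrite -scalar_mx_block col_mx0 block_mxEv.
rewrite !mul_col_mx !mul_mx_row !mulmx1 !mulmx0.
by rewrite !opp_col_mx !opp_row_mx !add_col_mx !add_row_mx !oppr0 !addr0 !add0r.
Qed.

Lemma tr_mul_cut_inv p (Mr : 'M[K]_(r, p)) (Ms : 'M[K]_(s, p))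
    (M' : 'M[K]_(n2 + n3, p)) :
  (col_mx (col_mx Mr Ms) M')^T *m cut_inv =
    row_mx (row_mx 0 (Ms^T *m invmx (J11ss D))) 0.
Proof.
rewrite 2!tr_col_mx /cut_inv !mulmxA mul_cut tr_cutE.
by rewrite !mul_mx_row mulmx1 !mulmx0.
Qed.

(** The flow rows are combined among themselves, while the output and
    resistive rows each receive a multiple of the truncated flow row. *)
Lemma fcrm_elim_mxE :
  fcrm_elim_mx D = block_mx elim_mx 0
    (col_mx (B^T *m cut_inv) (C^T *m cut_inv)) 1%:M.
Proof.
rewrite {1}portB_blocks {1}portC_blocks !tr_mul_cut_inv.
rewrite elim_mxE block_mxEv (scalar_mx_block m l 1) block_mxEv row_mx_col.
have z3 q : 0 = col_mx 0 (col_mx 0 0) :> 'M[K]_(r + (n2 + n3), q).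
  by rewrite !col_mx0.
by rewrite z3 !row_mx_col /fcrm_elim_mx /row6 !row_mx0.
Qed.

Hypotheses (skJ : J^T = - J) (uJ : J11ss D \in unitmx).

Lemma J11ss_skew : (J11ss D)^T = - J11ss D.
Proof. by rewrite -cutJcut trmx_skew_form. Qed.

Lemma cut_inv_skew : cut_inv^T = - cut_inv.
Proof.
rewrite /cut_inv !trmx_mul trmxK trmx_inv J11ss_skew -scaleN1r invmxZ.
  by rewrite invrN1 scaleN1r mulNmx mulmxN mulmxA.
by rewrite unitmxZ ?unitrN1.
Qed.

Lemma cut_invK : cut_inv *m J *m U = U.
Proof. by rewrite /cut_inv -!mulmxA (mulmxA U^T) cutJcut mulVmx // mulmx1. Qed.

Lemma cut_inv_keep : cut_inv *m P = 0.
Proof. by rewrite /cut_inv -mulmxA tr_cut_keep mulmx0. Qed.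

Lemma elim_mxJcut : elim_mx *m J *m U = 0.
Proof.
rewrite /elim_mx -2!(mulmxA P^T) !mulmxBl mul1mx -!(mulmxA J) cut_invK.
by rewrite subrr mulmx0.
Qed.

Lemma elim_mx_keep : elim_mx *m P = 1%:M.
Proof.
rewrite /elim_mx -mulmxA mulmxBl mul1mx -mulmxA cut_inv_keep mulmx0 subr0.
exact: tr_keepK.
Qed.

Lemma tr_elim_mx : elim_mx^T = (1%:M - cut_inv *m J) *m P.
Proof.
rewrite /elim_mx trmx_mul trmxK linearB /= trmx1 trmx_mul skJ cut_inv_skew.
by rewrite mulNmx mulmxN opprK.
Qed.

Lemma tr_elim_mul p (Mr : 'M[K]_(r, p)) (Ms : 'M[K]_(s, p))
    (M2 : 'M[K]_(n2, p)) (M3 : 'M[K]_(n3, p))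
    (M := col_mx (col_mx Mr Ms) (col_mx M2 M3)) :
  - (elim_mx *m M)^T =
  row_mx (Ms^T *m invmx (J11ss D) *m J11sr D - Mr^T)
         (row_mx (Ms^T *m invmx (J11ss D) *m J12s D - M2^T)
                 (Ms^T *m invmx (J11ss D) *m J13s D - M3^T)).
Proof.
rewrite trmx_mul tr_elim_mx mulmxBl mul1mx mulmxBr opprB /cut_inv.
rewrite -!mulmxA (mulmxA U^T J) tr_cutJkeep /M !tr_col_mx mul_keep.
rewrite (mulmxA _ U) mul_cut !mul_mx_row !opp_row_mx !add_row_mx.
by rewrite !mulmxA.
Qed.

Lemma calBE : calB D = - (elim_mx *m B)^T.
Proof. by rewrite portB_blocks tr_elim_mul. Qed.

Lemma calCE : calC D = - (elim_mx *m C)^T.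
Proof. by rewrite portC_blocks tr_elim_mul. Qed.

Lemma calGE : calG D = C^T *m cut_inv *m B.
Proof.
by rewrite /cut_inv /calG -tr_cut_portC -tr_cut_portB trmx_mul trmxK !mulmxA.
Qed.

Lemma calDE : calD D = C^T *m cut_inv *m C.
Proof. by rewrite /cut_inv /calD -tr_cut_portC trmx_mul trmxK !mulmxA. Qed.

Lemma calNE : calN D = B^T *m cut_inv *m B.
Proof. by rewrite /cut_inv /calN -tr_cut_portB trmx_mul trmxK !mulmxA. Qed.

(** Since [T J] annihilates the truncated coordinates, the correction in
    [T^T = (1 - K0 J) P] is invisible to it.  The right-hand side is a
    congruence of [J], whence the skew-symmetry of the Schur complement. *)
Lemma elimJ_congr : elim_mx *m J *m P = elim_mx *m J *m elim_mx^T.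
Proof.
rewrite tr_elim_mx mulmxBl mul1mx mulmxBr /cut_inv !mulmxA elim_mxJcut.
by rewrite !mul0mx subr0.
Qed.

Lemma elimJ_skew : (elim_mx *m J *m P)^T = - (elim_mx *m J *m P).
Proof.
rewrite elimJ_congr trmx_mul (trmx_mul elim_mx) trmxK skJ mulNmx mulmxN.
by rewrite mulmxA.
Qed.

Lemma keepJkeep : P^T *m J *m P =
  block_mx (J11rr D) (row_mx (J12r D) (J13r D))
           (lsubmx (dlsubmx J)) (drsubmx J).
Proof.
have JE : J = col_mx
    (col_mx (row_mx (row_mx (J11rr D) (J11rs D)) (row_mx (J12r D) (J13r D)))
            (row_mx (row_mx (J11sr D) (J11ss D)) (row_mx (J12s D) (J13s D))))
    (row_mx (row_mx (lsubmx (dlsubmx J)) (rsubmx (dlsubmx J))) (drsubmx J)).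
  rewrite hsubmxK -{1}[J]submxK -{1}[ulsubmx J]submxK -{1}[ursubmx J]submxK.
  by rewrite !block_mxEv row_mx_col.
rewrite {1}JE tr_keep_mul -block_mxEv block_mxEh -row_mx_col mul_keep.
by rewrite -block_mxEh.
Qed.

(** The blocks on and above the diagonal agree by a direct computation, the
    others because both sides are skew-symmetric. *)
Lemma calJE : calJ D = elim_mx *m J *m P.
Proof.
set X := RHS.
have XE : X = P^T *m J *m P -
    col_mx (J11rs D) (col_mx (J21s D) (J31s D)) *m invmx (J11ss D) *m
      row_mx (J11sr D) (row_mx (J12s D) (J13s D)).
  rewrite /X /elim_mx mulmxBr mulmx1 !mulmxBl; congr (_ - _).
  by rewrite /cut_inv -keepJcut -tr_cutJkeep !mulmxA.
move: XE; rewrite keepJkeep -{1}[drsubmx J]submxK !mul_col_mx !mul_mx_row.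
rewrite -row_mx_col -(block_mxEv _ (row_mx _ _)) opp_block_mx add_block_mx.
rewrite -block_mxEv !opp_row_mx !add_row_mx opp_block_mx add_block_mx => XE.
by have := elimJ_skew; rewrite -/X XE => /skew_block3 ->.
Qed.

End Elimination.

Section Reduction.
Context (K : realType) (r s n2 n3 m l : nat) (D : port_rep K r s n2 n3 m l).

Local Notation J := (portJ D).
Local Notation B := (portB D).
Local Notation C := (portC D).
Local Notation P := (keep_mx K r s n2 n3).
Local Notation U := (cut_mx K r s n2 n3).
Local Notation T := (elim_mx D).
Local Notation K0 := (cut_inv D).
Hypotheses (skJ : J^T = - J) (uJ : J11ss D \in unitmx).

Lemma fcrm_flowE (dx : 'cV[K]_(r + (n2 + n3))) :
  fcrm_flow s dx = - (P *m (sysE (fc_model D) *m dx)).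
Proof.
rewrite -[X in - X]addr0 -(mulmx0 _ U) keep_cut_colE /= -[X in _ *m X]vsubmxK.
rewrite mul_block_col -[dsubmx dx]vsubmxK mul_row_col col_mx0 mul_block_col.
rewrite !mul1mx !mul0mx !addr0 add0r col_mxKu col_mxKd !opp_col_mx !oppr0.
by rewrite /fcrm_flow.
Qed.

Lemma fcrm_effortE (x : 'cV[K]_(r + (n2 + n3))) (e1s : 'cV[K]_s) :
  fcrm_effort D x e1s = P *m (sysQ (fc_model D) *m x) + U *m e1s.
Proof.
rewrite keep_cut_colE /= -[X in _ *m X]vsubmxK mul_block_col.
rewrite -[dsubmx x]vsubmxK mul_row_col mul_col_mx mul_block_col.
rewrite !mul0mx !addr0 add_col_mx col_mxKu col_mxKd add0r.
by rewrite /fcrm_effort addrA.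
Qed.

(** Shared by the output row ([M = B]) and the resistive row ([M = C]): adding
    [M^T K0] times the flow rows to [- M^T] times the efforts cancels the
    truncated effort [w], because [K0 J U = U]. *)
Lemma tr_cut_inv_residual p q (M : 'M[K]_(r + s + (n2 + n3), p))
    (f e : 'M[K]_(r + (n2 + n3), q)) (w : 'M[K]_(s, q)) v :
  M^T *m K0 *m (- (P *m f) + J *m (P *m e + U *m w) + v) -
  M^T *m (P *m e + U *m w) = - (T *m M)^T *m e + M^T *m K0 *m v.
Proof.
rewrite 2!(mulmxDr (M^T *m K0)) (mulmxN (M^T *m K0)).
rewrite -[M^T *m K0 *m (P *m f)]mulmxA (mulmxA K0).
rewrite cut_inv_keep mul0mx mulmx0 oppr0 add0r addrAC; congr (_ + _).
rewrite trmx_mul tr_elim_mx // -!(mulmxA M^T) -mulmxBr mulNmx -mulmxN.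
rewrite -[RHS]mulmxA; congr (_ *m _); rewrite !mulmxDr !mulmxA cut_invK //.
by rewrite opprD addrACA subrr addr0 mulmxN !mulmxBl mul1mx opprB.
Qed.

(** The truncated effort leaves the flow rows because [T J U = 0], and the
    output and resistive rows by [tr_cut_inv_residual]. *)
Lemma fcrm_residualE (dx x : 'cV[K]_(r + (n2 + n3))) e1s fR eR u y
    (e := sysQ (fc_model D) *m x) :
  fcrm_elim_mx D *m port_residual D (fcrm_flow s dx) (fcrm_effort D x e1s)
                      fR eR u y =
  col_mx (- (sysE (fc_model D) *m dx) + calJ D *m e
           - (calC D)^T *m fR - (calB D)^T *m u)
    (col_mx (calB D *m e - (calG D)^T *m fR + calN D *m u + y)
            (calC D *m e + calD D *m fR + calG D *m u + eR)).
Proof.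
rewrite fcrm_elim_mxE // fcrm_flowE fcrm_effortE -/e /port_residual.
rewrite mul_block_col mul0mx addr0 mul1mx mul_col_mx add_col_mx.
rewrite -!(addrA _ (C *m fR)) !mulNmx.
congr col_mx; last congr col_mx.
- rewrite !mulmxDr !addrA mulmxN !mulmxA elim_mx_keep mul1mx elim_mxJcut //.
  rewrite mul0mx addr0 -calJE // calCE // calBE // !linearN /= !trmxK !mulNmx.
  by rewrite !opprK -!mulmxA.
- rewrite [LHS]addrA tr_cut_inv_residual -calBE //.
  rewrite (mulmxDr (B^T *m K0)) (mulmxA _ B) (mulmxA _ C) -calNE.
  rewrite calGE (trmx_skew_form _ _ (cut_inv_skew skJ uJ)) mulNmx opprK.
  by rewrite !addrA.
- rewrite [LHS]addrA tr_cut_inv_residual -calCE //.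
  rewrite (mulmxDr (C^T *m K0)) (mulmxA _ B) (mulmxA _ C) -calDE -calGE.
  by rewrite !addrA.
Qed.

Lemma calJ_skew : (calJ D)^T = - calJ D.
Proof. by rewrite calJE // elimJ_skew. Qed.

Lemma calD_skew : (calD D)^T = - calD D.
Proof. by rewrite calDE (trmx_skew_form _ _ (cut_inv_skew skJ uJ)). Qed.

Lemma calN_skew : (calN D)^T = - calN D.
Proof. by rewrite calNE (trmx_skew_form _ _ (cut_inv_skew skJ uJ)). Qed.

(** * Closing the resistive port *)

Hypothesis (pdRhat : pdmx (portRhat D)).

Lemma fcZ_split : fcZ D = fcZR D + fcZJ D.
Proof.
rewrite /fcZR /fcZJ; move: (fcZ D) => Z.
by apply/matrixP => i j; rewrite !mxE; lra.
Qed.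

Lemma fcZR_sym : (fcZR D)^T = fcZR D.
Proof. by rewrite /fcZR linearZ linearD /= trmxK addrC. Qed.

Lemma fcZJ_skew : (fcZJ D)^T = - fcZJ D.
Proof. by rewrite /fcZJ linearZ linearB /= trmxK -scalerN opprB. Qed.

Lemma fcZR_psd : psdmx (fcZR D).
Proof. exact: feedback_sympart_psd calD_skew pdRhat. Qed.

Lemma resistive_port (a eR fR : 'cV[K]_l) :
  (a + calD D *m fR + eR = 0 /\ fR = - portRhat D *m eR) <->
  (fR = fcZ D *m a /\ eR = - (invmx (1%:M - calD D *m portRhat D) *m a)).
Proof.
have uL := feedback_unitmx calD_skew pdRhat.
have key : calD D *m (- portRhat D *m eR) + eR =
    (1%:M - calD D *m portRhat D) *m eR.
  by rewrite mulNmx mulmxN mulmxA mulmxBl mul1mx addrC.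
split=> [[+ fRE]|[-> eRE]].
  rewrite fRE -addrA key => /eqP; rewrite addrC addr_eq0 => /eqP eq_eR.
  have eRE : eR = - (invmx (1%:M - calD D *m portRhat D) *m a).
    by rewrite -mulmxN -eq_eR mulKmx.
  by split=> //; rewrite eRE mulNmx mulmxN opprK mulmxA.
have fRE : fcZ D *m a = - portRhat D *m eR.
  by rewrite eRE mulNmx mulmxN opprK mulmxA.
by split=> //; rewrite fRE -addrA key eRE mulmxN mulKVmx // subrr.
Qed.

(** * The reduced model *)

Lemma fc_model_subJR : sysJ (fc_model D) - sysR (fc_model D) =
  calJ D - (calC D)^T *m fcZ D *m calC D.
Proof.
by rewrite /= fcZ_split mulmxDr mulmxDl opprD [LHS]addrAC addrA.
Qed.

Lemma fc_model_subBP : sysB (fc_model D) - sysP (fc_model D) =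
  - (calB D)^T - (calC D)^T *m fcZ D *m calG D.
Proof.
by rewrite /= fcZ_split mulmxDr mulmxDl opprD [LHS]addrAC addrA.
Qed.

Lemma fc_model_addBP : (sysB (fc_model D) + sysP (fc_model D))^T =
  - calB D + (calG D)^T *m fcZ D *m calC D.
Proof.
rewrite /= !linearD !linearN /= trmxK !trmx_form fcZJ_skew fcZR_sym.
rewrite mulmxN mulNmx opprK [in RHS]fcZ_split mulmxDr mulmxDl -addrA.
by rewrite [X in _ + X]addrC.
Qed.

Lemma fc_model_addSN : sysS (fc_model D) + sysN (fc_model D) =
  (calG D)^T *m fcZ D *m calG D - calN D.
Proof. by rewrite fcZ_split mulmxDr mulmxDl addrA. Qed.

(** The coefficients of the reduced model are those of the eliminated
    equations with the resistive flow [fR = Z (calC e + calG u)] inserted. *)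
Lemma fc_modelE (e : 'cV[K]_(r + (n2 + n3))) (u : 'cV[K]_m) (H := fc_model D)
    (fR := fcZ D *m (calC D *m e + calG D *m u)) :
  ((sysJ H - sysR H) *m e + (sysB H - sysP H) *m u =
     calJ D *m e - (calC D)^T *m fR - (calB D)^T *m u) /\
  ((sysB H + sysP H)^T *m e + (sysS H + sysN H) *m u =
     - (calB D *m e - (calG D)^T *m fR + calN D *m u)).
Proof.
rewrite fc_model_subJR fc_model_subBP fc_model_addBP fc_model_addSN.
rewrite /fR.
(* The coefficients are abstracted so that associativity does not look into
   the products by which they are defined. *)
move: (fcZ D) (calG D) (calC D) (calB D) (calN D) (calJ D) => Z G Cc Bc N Jc.
rewrite !mulmxDl !mulNmx !mulmxDr !mulmxA !opprD !opprK.
split; last by rewrite !addrA.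
by rewrite -!addrA; congr (_ + (_ + _)); rewrite addrC.
Qed.

(** Pointwise form of the equivalence.  The port variables are determined by
    the state and the input, while [e1s] is arbitrary, which is what makes the
    converse implication provide solutions of the port equations. *)
Lemma fcrm_closed_port (dx x : 'cV[K]_(r + (n2 + n3))) e1s fR eR
    (u y : 'cV[K]_m) (H := fc_model D)
    (a := calC D *m (sysQ H *m x) + calG D *m u) :
  fcrm_elim_mx D *m port_residual D (fcrm_flow s dx) (fcrm_effort D x e1s)
                      fR eR u y = 0 /\ fR = - portRhat D *m eR <->
  [/\ fR = fcZ D *m a,
      eR = - (invmx (1%:M - calD D *m portRhat D) *m a),
      sysE H *m dx = (sysJ H - sysR H) *m sysQ H *m x + (sysB H - sysP H) *m u
    & y = (sysB H + sysP H)^T *m sysQ H *m x + (sysS H + sysN H) *m u].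
Proof.
have [eqx eqy] := fc_modelE (sysQ H *m x) u.
rewrite -!(mulmxA _ (sysQ H)) -/H eqx eqy -/a fcrm_residualE // -/H.
rewrite (addrAC (calC D *m _)) -/a.
have stateE (V : zmodType) (z b c d : V) :
    (- z + b - c - d == 0) = (z == b - c - d).
  by rewrite -!addrA addrC subr_eq0 eq_sym.
have outE (V : zmodType) (z b : V) : (b + z == 0) = (z == - b).
  by rewrite addrC addr_eq0.
split=> [[/eqP]|[fRE eRE /eqP ex /eqP ey]].
  rewrite !col_mx_eq0 stateE outE => /and3P[/eqP ex /eqP ey /eqP ea] fRE.
  by have [fRa eRa] := (resistive_port a eR fR).1 (conj ea fRE); rewrite -fRa.
have [ea eb] := (resistive_port a eR fR).2 (conj fRE eRE).
by split=> //; apply/eqP; rewrite !col_mx_eq0 stateE outE ea eqxx fRE ex ey.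
Qed.

Lemma fcrm_solution_fc_model (I : set K) (x : K -> 'cV[K]_(r + (n2 + n3)))
    (u y : K -> 'cV[K]_m) :
  fcrm_solution D I x u y <-> dae_solution (fc_model D) I x u y.
Proof.
split=> [[dx [e1s [fR [eR sol]]]] t It|sol].
  have [_ _ ex ey] := (fcrm_closed_port _ _ _ _ _ _ _).1 (sol t It).
  by split=> //; apply: dx.
split=> [t /sol[]//|].
pose a t := calC D *m (sysQ (fc_model D) *m x t) + calG D *m u t.
exists (fun=> 0), (fun t => fcZ D *m a t),
  (fun t => - (invmx (1%:M - calD D *m portRhat D) *m a t)) => t It.
by have [_ ex ey] := sol t It; apply/fcrm_closed_port.
Qed.

(** Structural symmetry comes from [ZR] and [ZJ] being the symmetric and skew
    parts of [Z]; [Q^T E] only sees [Q11rr]; the passivity matrix is a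
    congruence of [ZR]. *)
Lemma fc_model_pHDAE : psdmx (Q11rr D) -> is_pHDAE (fc_model D).
Proof.
move=> psdQ11.
have QE : (sysQ (fc_model D))^T *m sysE (fc_model D) = block_mx (Q11rr D) 0 0 0.
  rewrite /= /block3 tr_block_mx !row_mx0 !col_mx0 !trmx0 mulmx_block.
  rewrite tr_col_mx mul_row_block tr_block_mx mulmx_block psdQ11.1 !trmx0.
  by rewrite mulmx1 !(mulmx0, mul0mx, addr0, row_mx0, block_mx0).
have WE : passivity_mx (fc_model D) =
    (row_mx (calC D *m sysQ (fc_model D)) (calG D))^T *m fcZR D *m
     row_mx (calC D *m sysQ (fc_model D)) (calG D).
  rewrite tr_row_mx mul_col_mx mul_col_row /passivity_mx (trmx_mul (calC D)).
  set Q := sysQ _; rewrite /= (trmx_form (fcZR D)) fcZR_sym.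
  by move: (fcZR D) (calG D) (calC D) Q => Z G C' Q; rewrite !mulmxA.
split.
- by rewrite /= (trmx_form (fcZR D)) fcZR_sym.
- rewrite /= linearB /= (trmx_skew_form _ _ fcZJ_skew) calN_skew.
  by rewrite opprB opprK addrC.
- set Q := sysQ _; rewrite /= linearB /= (trmx_skew_form _ _ fcZJ_skew).
  by rewrite calJ_skew -opprD mulmxN mulNmx.
- rewrite QE -[in RHS](trmxK (sysQ _)) -trmx_mul QE tr_block_mx psdQ11.1.
  by rewrite !trmx0.
- rewrite QE; split=> [|x]; first by rewrite tr_block_mx psdQ11.1 !trmx0.
  rewrite -[x]vsubmxK tr_col_mx mul_row_block mul_row_col.
  by rewrite !(mulmx0, addr0, mul0mx); apply: psdQ11.2.
- by rewrite WE; apply: psdmx_congr; apply: fcZR_psd.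
Qed.

End Reduction.

Theorem theorem4 (K : realType) (r s n2 n3 m l : nat) (hr : (r < r + s)%N)
  (Q11 : 'M[K]_(r + s)) (Q31 : 'M[K]_(n3, r + s)) (Q32 : 'M[K]_(n3, n2))
  (Q33 : 'M[K]_n3) (J R : 'M[K]_(r + s + (n2 + n3)))
  (B : 'M[K]_(r + s + (n2 + n3), m))
  (hpH : is_pHDAE (block_pHDAE Q11 Q31 Q32 Q33 J R B))
  (hJ : J = - J^T) (hR : psdmx R)
  (hJR13 : rsubmx (ursubmx (J - R)) = 0)
  (hJR23 : ursubmx (drsubmx (J - R)) = 0)
  (hQ11 : pdmx Q11) (hQ33 : Q33 \in unitmx)
  (Vhat : 'M[K]_(r + s)) (hV : Vhat \in unitmx)
  (C : 'M[K]_(r + s + (n2 + n3), l)) (Rhat : 'M[K]_l)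
  (hRhat : pdmx Rhat) (hC : C^T *m C = 1%:M)
  (hCR : invmx (state_transf n2 n3 Vhat) *m R *m
           (invmx (state_transf n2 n3 Vhat))^T = C *m Rhat *m C^T)
  (D : port_rep K r s n2 n3 m l)
  (hD : D = transformed_port_rep (block_pHDAE Q11 Q31 Q32 Q33 J R B)
              Vhat C Rhat)
  (hJss : J11ss D \in unitmx) :
  [/\ calJ D = - (calJ D)^T,
      1%:M - calD D *m portRhat D \in unitmx,
      is_pHDAE (fc_model D)
    & forall (I : set K) (x : K -> 'cV[K]_(r + (n2 + n3)))
             (u y : K -> 'cV[K]_m), open I ->
        fcrm_solution D I x u y <-> dae_solution (fc_model D) I x u y].
Proof.
have skJ : (portJ D)^T = - portJ D.
  by rewrite hD /= -{1}[invmx _]trmxK trmx_skew_form ?trmxK // {2}hJ opprK.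
have pdRhat : pdmx (portRhat D) by rewrite hD.
(* [Q11rr] is a principal block of the congruence [Vhat^T Q11 Vhat]. *)
have psdQ : psdmx (Q11rr D).
  have := psdmx_congr Vhat (pdmx_psdmx hQ11).
  rewrite hD /Q11rr /= /state_transf /block3 => /psd_ulsubmx.
  congr (psdmx (ulsubmx _)); rewrite !tr_block_mx !mulmx_block block_mxKul.
  by rewrite !row_mx0 !col_mx0 !trmx0 !mulmx0 !mul0mx !addr0.
split.
- by rewrite calJ_skew // opprK.
- by apply: feedback_unitmx => //; apply: calD_skew.
- exact: fc_model_pHDAE.
- by move=> I x u y _; apply: fcrm_solution_fc_model.
Qed.
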